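(* Let $D$ be a local Pauli basis on $L$ qubits, and let $\rho$ be any stabilizer mixed state on $L$ qubits, with von Neumann entropy $S(\rho)$ and relative entropy of coherence $C_D(\rho)$ in the basis $D$. Then, for an integer $M>C_D(\rho)$, there exists a sequence of $M$ local Pauli measurements that reduces the entropy of $\rho$: the state $\rho'$ after the measurements has entropy $S(\rho')<S(\rho)$.
   Context: $X_i,Y_i,Z_i$ denote the Pauli operators acting on qubit $i$ (identity elsewhere). A Pauli string is a tensor product of single-qubit operators from $\{I,X,Y,Z\}$ with a sign $\pm1$. A local Pauli basis $D$ is given by a choice of one Pauli operator $A_i\in\{X_i,Y_i,Z_i\}$ for each site $i=1,\dots,L$; its basis states are the common eigenvectors $|s\rangle$, $s=(\alpha_1,\dots,\alpha_L)\in\{0,1\}^L$, with $A_i|s\rangle=(-1)^{\alpha_i}|s\rangle$. The von Neumann entropy is $S(\rho)=-\mathrm{Tr}[\rho\log_2\rho]$. The relative entropy of coherence in the basis $D$ is $C_D(\rho)=S(\rho_D)-S(\rho)$, where $\rho_D=\sum_s \langle s|\rho|s\rangle\,|s\rangle\langle s|$ is the diagonal part of $\rho$ in the basis $D$. A stabilizer mixed state on $L$ qubits is a density matrix $\rho=2^{-(L-n)}\prod_{i=1}^{n}\frac{1+g_i}{2}$, where $g_1,\dots,g_n$ are independent, pairwise commuting signed Pauli strings generating a group that does not contain $-I$; then $S(\rho)=L-n$. A local Pauli measurement is a projective measurement of a single-qubit operator $P\in\{X_i,Y_i,Z_i\}$ for some site $i$, with the outcome recorded: outcome $\alpha\in\{0,1\}$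 occurs with probability $p_\alpha=\mathrm{Tr}[\Pi_\alpha\rho]$, $\Pi_\alpha=\frac{1+(-1)^\alpha P}{2}$, and the state becomes $\Pi_\alpha\rho\,\Pi_\alpha/p_\alpha$. The state $\rho'$ is the normalized state conditioned on the recorded outcomes.
   Formalization: The state is additionally assumed to have S(ρ) > 0 (truly mixed, n < L): for a pure stabilizer state (n = L, allowed by the definition) S(ρ) = 0 and S(ρ') < S(ρ) is impossible. *)

(* Defs.v *)
From HB Require Import structures.
From mathcomp Require Import all_boot all_order all_algebra.
From mathcomp Require Import reals exp.
From mathcomp.real_closed Require Export complex.

Set Implicit Arguments.
Unset Strict Implicit.
Unset Printing Implicit Defensive.

Import Order.TTheory GRing.Theory Num.Theory.
Local Open Scope ring_scope.
Local Open Scope complex_scope.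

(* The computational basis of L qubits is indexed by the bit strings
   {ffun 'I_L -> 'I_2}, enumerated by enum_val; there are 2 ^ L of them. *)
Definition qdim (L : nat) : nat := #|{ffun 'I_L -> 'I_2}|.

Definition bits (L : nat) (s : 'I_(qdim L)) : {ffun 'I_L -> 'I_2} :=
  enum_val s.

Definition tensor_mx (C : comPzRingType) (L : nat) (A : 'I_L -> 'M[C]_2) :
    'M[C]_(qdim L) :=
  \matrix_(s, t) \prod_(i < L) A i (bits s i) (bits t i).

Definition tensor_cv (C : comPzRingType) (L : nat) (v : 'I_L -> 'cV[C]_2) :
    'cV[C]_(qdim L) :=
  \col_s \prod_(i < L) v i (bits s i) 0.

Inductive axis : Type := AX | AY | AZ.

Section Operators.
Variable R : realType.
Local Notation C := R[i].

Definition sigma (a : axis) : 'M[C]_2 :=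
  match a with
  | AX => \matrix_(j, k) (j != k)%:R
  | AY => \matrix_(j, k) (if j == k then 0 else if j == 0 then - 'i%C else 'i%C)
  | AZ => \matrix_(j, k) (if j == k then (-1) ^+ j else 0)
  end.

(* Unit eigenvector of sigma a for the eigenvalue (-1) ^+ alpha. *)
Definition eigket (a : axis) (alpha : bool) : 'cV[C]_2 :=
  match a with
  | AX => \col_j ((sqrtC 2)^-1 * (if j == 0 then 1 else (-1) ^+ alpha))
  | AY => \col_j ((sqrtC 2)^-1 * (if j == 0 then 1 else (-1) ^+ alpha * 'i%C))
  | AZ => \col_j (j == alpha :> nat)%:R
  end.

Definition site_pauli (L : nat) (P : 'I_L * axis) : 'M[C]_(qdim L) :=
  tensor_mx (fun j => if j == P.1 then sigma P.2 else 1%:M).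

(* The letter None stands for the identity. *)
Record pauli_string (L : nat) := PauliString {
  negative : bool;
  letter : 'I_L -> option axis
}.

Definition string_mx (L : nat) (g : pauli_string L) : 'M[C]_(qdim L) :=
  (-1) ^+ negative g *: tensor_mx (fun i => oapp sigma 1%:M (letter g i)).

Inductive generated (d : nat) (G : 'M[C]_d -> Prop) : 'M[C]_d -> Prop :=
| generated_one : generated G 1%:M
| generated_mem A of G A : generated G A
| generated_mul A B of generated G A & generated G B : generated G (A *m B)
| generated_inv A of generated G A : generated G (invmx A).

Definition stabilizer_generators (L n : nat) (g : 'I_n -> pauli_string L) :
    Prop :=
  [/\ forall i j, comm_mx (string_mx (g i)) (string_mx (g j)),
      forall i, ~ generated (fun A => exists2 j, j != i & A = string_mx (g j))
                            (string_mx (g i))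
    & ~ generated (fun A => exists j, A = string_mx (g j)) (- 1%:M)].

(* These hypotheses on g force n <= L, so the subtraction is a true one. *)
Definition is_stabilizer_state (L : nat) (rho : 'M[C]_(qdim L)) : Prop :=
  exists (n : nat) (g : 'I_n -> pauli_string L),
    stabilizer_generators g /\
    rho = (2 ^- (L - n)) *:
          \prod_(i < n) (2^-1 *: (1%:M + string_mx (g i))).

Definition log2 (x : R) : R := ln x / ln 2.

(* Spectral calculus: A = invmx U *m diag_mx d *m U with U unitary when A is
   normal.  Since ln 0 = 0, the convention 0 * log2 0 = 0 holds. *)
Definition log2_mx (d : nat) (A : 'M[C]_d) : 'M[C]_d :=
  invmx (spectralmx A)
    *m diag_mx (map_mx (fun z : C => (log2 (complex.Re z))%:C) (spectral_diag A))
    *m spectralmx A.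

Definition vn_entropy (d : nat) (rho : 'M[C]_d) : R :=
  - complex.Re (\tr (rho *m log2_mx rho)).

Section Coherence.
Variables (L : nat) (D : 'I_L -> axis).

Definition basis_ket (s : {ffun 'I_L -> bool}) : 'cV[C]_(qdim L) :=
  tensor_cv (fun i => eigket (D i) (s i)).

Definition basis_bra (s : {ffun 'I_L -> bool}) : 'rV[C]_(qdim L) :=
  map_mx Num.conj (basis_ket s)^T.

Definition diagonal_part (rho : 'M[C]_(qdim L)) : 'M[C]_(qdim L) :=
  \sum_(s : {ffun 'I_L -> bool})
    (basis_bra s *m rho *m basis_ket s) 0 0 *: (basis_ket s *m basis_bra s).

Definition coherence (rho : 'M[C]_(qdim L)) : R :=
  vn_entropy (diagonal_part rho) - vn_entropy rho.

End Coherence.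

Section Measurements.
Variable L : nat.
Implicit Types (rho : 'M[C]_(qdim L)) (P : 'I_L * axis) (alpha : bool).

Definition outcome_proj P alpha : 'M[C]_(qdim L) :=
  2^-1 *: (1%:M + (-1) ^+ alpha *: site_pauli P).

Definition outcome_prob rho P alpha : C := \tr (outcome_proj P alpha *m rho).

Definition post_state rho P alpha : 'M[C]_(qdim L) :=
  (outcome_prob rho P alpha)^-1 *:
    (outcome_proj P alpha *m rho *m outcome_proj P alpha).

(* A record lists the measured operators with their outcomes, in order. *)
Fixpoint record_prob rho (r : seq (('I_L * axis) * bool)) : C :=
  if r is (P, alpha) :: r' then
    outcome_prob rho P alpha * record_prob (post_state rho P alpha) r'
  else 1.

Fixpoint record_state rho (r : seq (('I_L * axis) * bool)) : 'M[C]_(qdim L) :=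
  if r is (P, alpha) :: r' then record_state (post_state rho P alpha) r'
  else rho.

End Measurements.
End Operators.

(* Main.v *)
(* Write the group generated by the stabilizers as (g_v), v in F_2^n, and the
   local Pauli strings in the basis D as (A_u), u in F_2^L, with
   A_u g_v = (-1)^(u B v^T) g_v A_u.  Then rho = 2^-(L-n) P with P the average
   of the g_v, and dephasing in D keeps only the g_v with B v^T = 0, so the
   coherence is the rank c of B over F_2.
   Measuring A_t for t in a set T lowers the entropy as soon as some A_u with u
   supported on T commutes with the whole group but A_u P <> +-P.  Since n < L,
   counting shows that such a u exists in ker B, and ker B is generated by
   vectors of weight at most c + 1 <= M, one of which must work. *)
Require Import Defs.
From mathcomp Require Import all_boot all_order all_algebra.
From mathcomp Require Import reals exp.
From mathcomp.real_closed Require Import complex.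
From mathcomp Require Import mxabelem.

Set Implicit Arguments.
Unset Strict Implicit.
Unset Printing Implicit Defensive.

Import Order.TTheory GRing.Theory Num.Theory.
Local Open Scope ring_scope.
Local Open Scope sesquilinear_scope.

(** The measured state is never identified as a stabilizer state. All states compared here are flat:
    Hermitian with [X^2 = a X]. Such an [X] of trace one has entropy [-log2 a], so only the scalar
    [a] has to be tracked, for [rho], for its dephased version and for the state after the
    measurements. Let [Pi] be the product of the outcome projections, itself the average of signed
    strings [a_w] over w in F_2^M, and let [l = 2^-(L-n)]. The operator [Pi P Pi] squares to [mu]
    times itself, where [mu] is the fraction of the w whose string commutes with every [g_v].
    Normalizing by the probability [p] of the record turns the eigenvalue [l] into [l mu / p], so
    the entropy drops exactly when [p < mu]. This is a trace inequality, strict as soon as one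
    commuting [a_w] does not fix [P]. The outcomes decide the sign of [a_w], which is why both [P]
    and [-P] must be excluded. The operators can then be chosen before any outcome is known. *)

Section SignCharacter.
Context {C : numDomainType}.

Definition sgn (x : 'F_2) : C := (-1) ^+ x.

Lemma F2_cases (x : 'F_2) : x = 0 \/ x = 1.
Proof. by case: x => [[|[|//]] ?]; [left | right]; apply/val_inj. Qed.

Lemma F2_addrr (x : 'F_2) : x + x = 0.
Proof. by case: (F2_cases x) => ->; apply/val_inj. Qed.

Lemma rVF2_addrr m (u : 'rV['F_2]_m) : u + u = 0.
Proof. by apply/rowP => i; rewrite !mxE F2_addrr. Qed.

Lemma sgn0 : sgn 0 = 1. Proof. by []. Qed.

Lemma sgnD x y : sgn (x + y) = sgn x * sgn y.
Proof.
case: (F2_cases x) => ->; case: (F2_cases y) => ->;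
  rewrite ?F2_addrr ?addr0 ?add0r /sgn ?mulr1 ?mul1r //.
by rewrite expr1 mulrNN mulr1.
Qed.

Lemma sgn_sqr x : sgn x * sgn x = 1.
Proof. by rewrite -sgnD F2_addrr. Qed.

Lemma sgn_sum (I : finType) (F : I -> 'F_2) :
  sgn (\sum_i F i) = \prod_i sgn (F i).
Proof. exact: (big_morph _ sgnD). Qed.

Lemma sum_sgn m (y : 'cV['F_2]_m) :
  \sum_(u : 'rV['F_2]_m) sgn ((u *m y) 0 0) = if y == 0 then 2 ^+ m else 0.
Proof.
case: eqVneq => [->|y0].
  under eq_bigr do rewrite mulmx0 mxE.
  by rewrite sumr_const cardT -cardE card_mx card_Fp // mul1n natrX.
have [i yi] : exists i, y i 0 = 1.
  by have /cV0Pn[i yi] := y0; exists i; case: (F2_cases (y i 0)) yi => ->.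
apply/eqP; rewrite -eqNr; apply/eqP.
rewrite [RHS](reindex_inj (addrI (delta_mx 0 i))) -sumrN /=.
apply: eq_bigr => u _; rewrite mulmxDl -rowE !mxE yi sgnD.
by rewrite {2}/sgn expr1 mulN1r.
Qed.

End SignCharacter.

(** * Products of commuting involutions, indexed by F_2^m *)

Section Monomials.
Variable Rg : pzRingType.

(** The factors are later matrices, so the product is ordered by index. [Rg] may be the zero ring
    because a matrix dimension is not known to be positive from its form. *)
Definition monomial m (x : 'I_m -> Rg) (v : 'rV['F_2]_m) : Rg :=
  \prod_i x i ^+ v 0 i.

Section Involutions.
Variables (m : nat) (x : 'I_m -> Rg).
Hypothesis xC : forall i j, GRing.comm (x i) (x j).
Hypothesis xx : forall i, x i * x i = 1.

Lemma monomial0 : monomial x 0 = 1.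
Proof. by rewrite /monomial big1 // => i _; rewrite mxE. Qed.

Lemma monomialD : {morph monomial x : u v / u + v >-> u * v}.
Proof.
move=> u v; rewrite /monomial -prodrM_comm => [|i j _ _]; last first.
  by apply/commrX/commr_sym/commrX/xC.
apply: eq_bigr => i _; rewrite mxE.
by case: (F2_cases (u 0 i)) => ->; case: (F2_cases (v 0 i)) => ->;
  rewrite ?F2_addrr ?addr0 ?add0r ?mulr1 ?mul1r ?xx.
Qed.

End Involutions.

Lemma prod1D_monomial m (x : 'I_m -> Rg) :
  \prod_i (1 + x i) = \sum_v monomial x v.
Proof.
have -> : \prod_i (1 + x i) = \prod_i \sum_(b : 'F_2) x i ^+ b.
  by apply: eq_bigr => i _; rewrite big_ord_recl big_ord1.
rewrite bigA_distr_bigA /=.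
rewrite (reindex (fun v : 'rV['F_2]_m => [ffun i => v 0 i])) /=.
  by apply: eq_bigr => v _; apply: eq_bigr => i _; rewrite ffunE.
exists (fun f : {ffun 'I_m -> 'F_2} => \row_i f i) => [v _|f _].
  by apply/rowP => i; rewrite mxE ffunE.
by apply/ffunP => i; rewrite ffunE mxE.
Qed.

End Monomials.

(** * Group averages as projections, and twirling *)

Section Averages.
Variables (C : numClosedFieldType) (d : nat).

(** Common interface of three families: the local strings of the basis, the stabilizer group, and
    the measured strings with the signs given by the outcomes. *)
Record involutive_rep m (h : 'rV['F_2]_m -> 'M[C]_d) : Prop := InvolutiveRep {
  rep0 : h 0 = 1%:M;
  repD : {morph h : u v / u + v >-> u *m v};
  rep_herm : forall u, (h u)^t* = h u
}.

Lemma rep_mulmx_self m (h : 'rV['F_2]_m -> 'M[C]_d) :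
  involutive_rep h -> forall u, h u *m h u = 1%:M.
Proof. by move=> hR u; rewrite -repD // rVF2_addrr rep0. Qed.

Lemma rep_comm m (h : 'rV['F_2]_m -> 'M[C]_d) :
  involutive_rep h -> forall u v, h u *m h v = h v *m h u.
Proof. by move=> hR u v; rewrite -!repD // addrC. Qed.

Lemma trmxC_mul m n p (A : 'M[C]_(m, n)) (B : 'M[C]_(n, p)) :
  (A *m B)^t* = B^t* *m A^t*.
Proof. by rewrite trmx_mul map_mxM. Qed.

Lemma trmxC_scale m n (a : C) (A : 'M[C]_(m, n)) : (a *: A)^t* = a^* *: A^t*.
Proof. by rewrite linearZ map_mxZ. Qed.

Lemma trmxC_sum m n (I : finType) (Q : pred I) (F : I -> 'M[C]_(m, n)) :
  (\sum_(i | Q i) F i)^t* = \sum_(i | Q i) (F i)^t*.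
Proof. by rewrite linear_sum raddf_sum. Qed.

Definition average m (h : 'rV['F_2]_m -> 'M[C]_d) : 'M[C]_d :=
  2 ^- m *: \sum_u h u.

Section OneRep.
Variables (m : nat) (h : 'rV['F_2]_m -> 'M[C]_d).
Hypothesis hR : involutive_rep h.

Lemma rep_average u : h u *m average h = average h.
Proof.
rewrite /average -scalemxAr mulmx_sumr; congr (_ *: _).
rewrite [RHS](reindex_inj (addrI u)) /=.
by apply: eq_bigr => v _; rewrite repD.
Qed.

Lemma average_rep u : average h *m h u = average h.
Proof.
rewrite -[in RHS](rep_average u) /average -scalemxAl -scalemxAr.
congr (_ *: _); rewrite mulmx_suml mulmx_sumr.
by apply: eq_bigr => v _; rewrite rep_comm.
Qed.

Lemma average_herm : (average h)^t* = average h.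
Proof.
rewrite /average trmxC_scale trmxC_sum fmorphV rmorphXn /= conjC_nat.
by congr (_ *: _); apply: eq_bigr => u _; rewrite rep_herm.
Qed.

Lemma average_idem : average h *m average h = average h.
Proof.
rewrite {1}/average -scalemxAl mulmx_suml.
under eq_bigr do rewrite rep_average.
rewrite sumr_const card_mx card_Fp // mul1n -scaler_nat natrX scalerA mulVf ?scale1r //.
by rewrite expf_neq0 // pnatr_eq0.
Qed.

End OneRep.

Section TwoReps.
Variables (m n : nat) (a : 'rV['F_2]_m -> 'M[C]_d) (g : 'rV['F_2]_n -> 'M[C]_d).
Variable B : 'M['F_2]_(m, n).
Hypothesis aR : involutive_rep a.
Hypothesis gR : involutive_rep g.
Hypothesis ag : forall u v,
  a u *m g v = sgn ((u *m B *m v^T) 0 0) *: (g v *m a u).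

(* For u B != 0 the sign v |-> sgn (u B v^T) is a nontrivial character, so the
   group average cancels. *)
Lemma average_compress u :
  average g *m a u *m average g = if u *m B == 0 then a u *m average g else 0.
Proof.
have -> : average g *m a u *m average g =
    2 ^- n *: \sum_(v : 'rV_n) (sgn ((u *m B *m v^T) 0 0) *: (a u *m average g)).
  rewrite {1}/average -!scalemxAl !mulmx_suml; congr (_ *: _).
  apply: eq_bigr => v _; rewrite -[in RHS](rep_average gR v).
  by rewrite mulmxA ag -scalemxAl scalerA sgn_sqr scale1r.
rewrite -scaler_suml.
have -> : \sum_(v : 'rV_n) sgn ((u *m B *m v^T) 0 0) =
          \sum_(v : 'rV_n) sgn ((v *m (u *m B)^T) 0 0) :> C.
  by apply: eq_bigr => v _; rewrite -[u *m B]trmxK -trmx_mul mxE trmxK.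
rewrite sum_sgn trmx_eq0; case: eqP => _; last by rewrite scale0r scaler0.
by rewrite scalerA mulVf ?scale1r // expf_neq0 // pnatr_eq0.
Qed.

(** Conjugation by [a u] multiplies [g v] by a character of [u], trivial exactly when [B v^T = 0].
    Together with the twirl form of dephasing this selects the surviving group elements. *)
Lemma twirl v : \sum_u a u *m g v *m a u =
  if B *m v^T == 0 then 2 ^+ m *: g v else 0.
Proof.
have -> : \sum_u a u *m g v *m a u =
    \sum_(u : 'rV_m) sgn ((u *m (B *m v^T)) 0 0) *: g v.
  apply: eq_bigr => u _.
  by rewrite ag -scalemxAl -[g v *m _ *m _]mulmxA rep_mulmx_self // mulmx1 mulmxA.
rewrite -scaler_suml sum_sgn; case: eqP => // _; exact: scale0r.
Qed.

Lemma twirl_average : \sum_u a u *m average g *m a u =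
  (2 ^+ m / 2 ^+ n) *: \sum_(v | B *m v^T == 0) g v.
Proof.
have -> : \sum_u a u *m average g *m a u =
    2 ^- n *: \sum_v \sum_u a u *m g v *m a u.
  rewrite exchange_big scaler_sumr; apply: eq_bigr => u _.
  by rewrite /average -scalemxAr -scalemxAl mulmx_sumr mulmx_suml.
under eq_bigr do rewrite twirl.
by rewrite -big_mkcond -scaler_sumr scalerA mulrC.
Qed.

End TwoReps.

End Averages.

(** * Trace inequalities for a measured projection *)

Section Traces.
Variables (C : numClosedFieldType) (d : nat).

Lemma trace_mulmx_trC (X : 'M[C]_d) :
  \tr (X *m X^t*) = \sum_i \sum_j `|X i j| ^+ 2.
Proof.
rewrite /mxtrace; apply: eq_bigr => i _; rewrite mxE.
by apply: eq_bigr => j _; rewrite !mxE normCK.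
Qed.

Lemma trace_mulmx_trC_ge0 (X : 'M[C]_d) : 0 <= \tr (X *m X^t*).
Proof.
rewrite trace_mulmx_trC; apply: sumr_ge0 => i _; apply: sumr_ge0 => j _.
by rewrite exprn_ge0.
Qed.

Lemma trace_mulmx_trC_eq0 (X : 'M[C]_d) : \tr (X *m X^t*) = 0 -> X = 0.
Proof.
rewrite trace_mulmx_trC => X0; apply/matrixP => i j; rewrite mxE.
have sq0 k l : 0 <= `|X k l| ^+ 2 by rewrite exprn_ge0.
have rowX0 k := psumr_eq0P (fun k _ => sumr_ge0 _ (fun l _ => sq0 k l)) X0 (i := k) isT.
have /eqP := psumr_eq0P (fun l _ => sq0 i l) (rowX0 i) (i := j) isT.
by rewrite sqrf_eq0 normr_eq0 => /eqP.
Qed.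

Section InvolutionTimesProjection.
Variables A P : 'M[C]_d.
Hypotheses (A_herm : A^t* = A) (AA : A *m A = 1%:M).
Hypotheses (P_herm : P^t* = P) (PP : P *m P = P).

(* Both trace bounds below read off the squared Hilbert-Schmidt norm of P - A P. *)
Let norm_diff : \tr ((P - A *m P) *m (P - A *m P)^t*) = 2 * (\tr P - \tr (A *m P)).
Proof.
have -> : (P - A *m P)^t* = P - P *m A.
  by rewrite linearB map_mxB /= trmxC_mul P_herm A_herm.
rewrite mulmxBl !mulmxBr !raddfB /= -!mulmxA [P *m (P *m A)]mulmxA PP.
rewrite [\tr (A *m (P *m A))]mxtrace_mulC -mulmxA AA mulmx1 [\tr (P *m A)]mxtrace_mulC.
by rewrite opprK mulr_natl mulr2n [- _ + _]addrC.
Qed.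

Lemma trace_involution_le : \tr (A *m P) <= \tr P.
Proof.
have := trace_mulmx_trC_ge0 (P - A *m P).
by rewrite norm_diff pmulr_rge0 ?ltr0n // subr_ge0.
Qed.

Lemma trace_involution_eq : \tr (A *m P) = \tr P -> A *m P = P.
Proof.
move=> trE; apply/esym/eqP; rewrite -subr_eq0; apply/eqP/trace_mulmx_trC_eq0.
by rewrite norm_diff trE subrr mulr0.
Qed.

Lemma trace_involution_lt : A *m P != P -> \tr (A *m P) < \tr P.
Proof.
move=> neqP; rewrite lt_neqAle trace_involution_le andbT.
by apply: contraNneq neqP => /trace_involution_eq ->.
Qed.

End InvolutionTimesProjection.

Section MeasuredAverage.
Variables (m n : nat) (a : 'rV['F_2]_m -> 'M[C]_d) (g : 'rV['F_2]_n -> 'M[C]_d).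
Variable B : 'M['F_2]_(m, n).
Hypothesis aR : involutive_rep a.
Hypothesis gR : involutive_rep g.
Hypothesis ag : forall u v,
  a u *m g v = sgn ((u *m B *m v^T) 0 0) *: (g v *m a u).

Local Notation N := [pred u : 'rV['F_2]_m | u *m B == 0].
Local Notation Pi := (average a).
Local Notation P := (average g).

Lemma average_sandwich :
  P *m Pi *m P = 2 ^- m *: \sum_(u in N) a u *m P.
Proof.
rewrite [Pi]/average -[P *m (_ *: _)]scalemxAr -[(_ *: _) *m P]scalemxAl.
rewrite [P *m _]mulmx_sumr mulmx_suml.
by under eq_bigr do rewrite (average_compress gR ag); rewrite -big_mkcond.
Qed.

(** The inner [P Pi P] is a sum of [a u P] over [N], and the outer [Pi] absorbs each [a u], leaving
    #|N| equal terms. *)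
Lemma measured_average_sqr :
  (Pi *m P *m Pi) *m (Pi *m P *m Pi) = (2 ^- m * #|N|%:R) *: (Pi *m P *m Pi).
Proof.
have -> : (Pi *m P *m Pi) *m (Pi *m P *m Pi) = Pi *m (P *m Pi *m P) *m Pi.
  by rewrite !mulmxA -[Pi *m P *m Pi *m Pi]mulmxA average_idem.
rewrite average_sandwich -[Pi *m (_ *: _)]scalemxAr -[(_ *: _) *m Pi]scalemxAl.
rewrite -scalerA; congr (_ *: _).
rewrite [X in X *m Pi = _]mulmx_sumr [LHS]mulmx_suml.
under eq_bigr do rewrite mulmxA average_rep //.
by rewrite sumr_const scaler_nat.
Qed.

(** By cyclicity the trace is that of [P Pi P], a sum of [tr (a w P)] over [N]. Each term is at most
    [tr P], and the one at [u] is strictly smaller. *)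
Lemma trace_measured_average_lt u :
  u \in N -> a u *m P != P -> \tr (Pi *m P) < 2 ^- m * #|N|%:R * \tr P.
Proof.
move=> uN auP.
have -> : \tr (Pi *m P) = 2 ^- m * \sum_(w in N) \tr (a w *m P).
  rewrite -[in LHS](average_idem gR) mulmxA mxtrace_mulC mulmxA average_sandwich.
  by rewrite linearZ linear_sum.
have Pherm := average_herm gR; have PP := average_idem gR.
rewrite -mulrA ltr_pM2l ?invr_gt0 ?exprn_gt0 ?ltr0n //.
rewrite mulr_natl -sumr_const (bigD1 u) //= [ltRHS](bigD1 u) //=.
apply: ltr_leD.
  by apply: trace_involution_lt => //; [exact: rep_herm | exact: rep_mulmx_self].
apply: ler_sum => w _.
by apply: trace_involution_le => //; [exact: rep_herm | exact: rep_mulmx_self].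
Qed.

End MeasuredAverage.

End Traces.

(** Every eigenvalue is 0 or [a]. At the eigenvalue 0 the factor [X] kills whatever [f 0] is, so the
    functional calculus reduces to the scalar [f a]. *)
Lemma spectral_flat (C : numClosedFieldType) d (X : 'M[C]_d) (a : C) (f : C -> C) :
  X \is normalmx -> X *m X = a *: X ->
  X *m (invmx (spectralmx X) *m diag_mx (map_mx f (spectral_diag X)) *m spectralmx X) =
  f a *: X.
Proof.
move=> /orthomx_spectralP; move: (spectral_unit X).
move: (spectralmx X) (spectral_diag X) => U D U_unit X_E XX.
have conj_mul (E F : 'M[C]_d) :
    (invmx U *m E *m U) *m (invmx U *m F *m U) = invmx U *m (E *m F) *m U.
  by rewrite !mulmxA mulmxK.
have DD i : D 0 i * D 0 i = a * D 0 i.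
  have : diag_mx D *m diag_mx D = a *: diag_mx D.
    move: XX; rewrite X_E conj_mul scalemxAl scalemxAr.
    move=> /(congr1 (fun Y => U *m Y *m invmx U)).
    by rewrite !mulmxA mulmxV // !mul1mx !mulmxK.
  by rewrite mulmx_diag => /matrixP/(_ i i); rewrite !mxE eqxx !mulr1n.
rewrite X_E conj_mul scalemxAl scalemxAr mulmx_diag -linearZ /=.
congr (_ *m diag_mx _ *m _); apply/rowP => i; rewrite !mxE.
have /eqP := DD i; rewrite -subr_eq0 -mulrBl mulf_eq0 subr_eq0.
by case/orP => /eqP ->; [rewrite mulrC | rewrite mul0r mulr0].
Qed.

Lemma vn_entropy_flat (R : realType) d (X : 'M[R[i]]_d) (a : R[i]) :
  X^t* = X -> X *m X = a *: X ->
  vn_entropy X = - (log2 (complex.Re a) * complex.Re (\tr X)).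
Proof.
move=> X_herm XX; congr (- _); rewrite /log2_mx (spectral_flat _ _ XX); last first.
  by apply/normalmxP; rewrite X_herm.
by rewrite linearZ /=; case: (\tr X) => x y /=; rewrite mul0r subr0.
Qed.

(** * Kernel vectors of small support *)

Section SparseKernel.

Lemma card_ker_F2 m n (B : 'M['F_2]_(m, n)) :
  #|[pred u : 'rV_m | u *m B == 0]| = (2 ^ (m - \rank B))%N.
Proof.
transitivity #|rowg (kermx B)|; last by rewrite card_rowg mxrank_ker card_Fp.
by apply: eq_card => u; rewrite !inE sub_kermx.
Qed.

(* The rows of Y are the unit vectors e_i corrected along the rank-many pivot
   rows selected by maxrankfun, hence the bound on their supports. *)
Lemma sparse_kernel_basis (F : fieldType) m n (B : 'M[F]_(m, n)) :
  exists Y : 'M_m, [/\ Y *m B = 0, forall u : 'rV_m, u *m B = 0 -> u *m Y = u &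
    forall i, (row i Y <= row i 1%:M + rowsub (maxrankfun B) 1%:M)%MS].
Proof.
set S := rowsub (maxrankfun B) 1%:M; set X := B *m pinvmx (rowsub (maxrankfun B) B).
have SB : S *m B = rowsub (maxrankfun B) B by rewrite mul_rowsub_mx mul1mx.
exists (1%:M - X *m S); split=> [|u uB0|i].
- rewrite mulmxBl mul1mx -mulmxA SB mulmxKpV ?subrr //.
  by rewrite eq_maxrowsub.
- by rewrite mulmxBr mulmx1 /X !mulmxA uB0 !mul0mx subr0.
- rewrite linearB /= addmx_sub //; first exact: addsmxSl.
  by rewrite eqmx_opp row_mul (submx_trans (submxMl _ _)) // addsmxSr.
Qed.

(** The rows of [Y] generate the kernel, and [H] is closed under sums, so a failure of [H] in the
    kernel is already a failure at some row. That row is supported on one site [i] and the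
    pivots. *)
Lemma sparse_kernel_witness m n (B : 'M['F_2]_(m, n)) (H : pred 'rV['F_2]_m) M u :
    H 0 -> (forall v w, H v -> H w -> H (v + w)) ->
    (\rank B < M)%N -> u *m B = 0 -> ~~ H u ->
  exists (t : 'I_M -> 'I_m) (w : 'rV_M),
    w *m rowsub t 1%:M *m B = 0 /\ ~~ H (w *m rowsub t 1%:M).
Proof.
move=> H0 HD ltM uB0 Hu; have [Y [YB0 uY Ysub]] := sparse_kernel_basis B.
have [i HYi] : exists i, ~~ H (row i Y).
  apply/existsP; rewrite -negb_forall; apply: contraNN Hu => /forallP HY.
  rewrite -(uY u uB0) mulmx_sum_row; apply: (big_ind (fun v => is_true (H v))) => // j _.
  by case: (F2_cases (u 0 j)) => ->; rewrite ?scale0r ?scale1r.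
(* The first [\rank B] entries list the pivots, entry number [\rank B] is [i], and any further
   entries repeat [i] as padding up to exactly [M]. *)
pose t (k : 'I_M) := if insub (k : nat) is Some j then maxrankfun B j else i.
have /submxP[w wE] : (row i Y <= rowsub t (1%:M : 'M['F_2]_m))%MS.
  apply: submx_trans (Ysub i) _; rewrite addsmx_sub; apply/andP; split.
    have -> : row i 1%:M = row (Ordinal ltM) (rowsub t (1%:M : 'M['F_2]_m)).
      by rewrite row_rowsub /t insubF //= ltnn.
    exact: row_sub.
  apply/row_subP => j; have jM : (j < M)%N by exact: ltn_trans (ltn_ord j) ltM.
  have -> : row j (rowsub (maxrankfun B) 1%:M) =
            row (Ordinal jM) (rowsub t (1%:M : 'M['F_2]_m)).
    by rewrite !row_rowsub /t /= valK.
  exact: row_sub.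
exists t, w; rewrite -wE; split=> //; by rewrite -row_mul YB0 row0.
Qed.

End SparseKernel.

(** * Tensor products of single-site matrices *)

Section Tensor.
Variable C : comPzRingType.

Lemma sum_bits L (F : {ffun 'I_L -> 'I_2} -> C) :
  \sum_(s < qdim L) F (bits s) = \sum_f F f.
Proof.
rewrite (reindex (@bits L)) //.
by exists (@enum_rank _) => [s _|f _]; [exact: enum_valK | exact: enum_rankK].
Qed.

Lemma eq_tensor_mx L (A B : 'I_L -> 'M[C]_2) :
  A =1 B -> tensor_mx A = tensor_mx B.
Proof. by move=> AB; apply/matrixP => s t; rewrite !mxE; under eq_bigr do rewrite AB. Qed.

Lemma tensor_mulmx L (A B : 'I_L -> 'M[C]_2) :
  tensor_mx A *m tensor_mx B = tensor_mx (fun i => A i *m B i).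
Proof.
apply/matrixP => s t; rewrite !mxE.
under eq_bigr do rewrite !mxE -big_split /=.
rewrite (sum_bits (fun f => \prod_i (A i (bits s i) (f i) * B i (f i) (bits t i)))).
rewrite -(bigA_distr_bigA (fun i j => A i (bits s i) j * B i j (bits t i))).
by apply: eq_bigr => i _; rewrite mxE.
Qed.

Lemma tensor_mx1 L : tensor_mx (fun _ : 'I_L => 1%:M) = 1%:M :> 'M[C]_(qdim L).
Proof.
apply/matrixP => s t; rewrite !mxE; case: eqVneq => [->|neq].
  by rewrite big1 // => i _; rewrite mxE eqxx.
have [i si] : exists i, bits s i != bits t i.
  apply/existsP; rewrite -negb_forall; apply: contraNN neq => /eqfunP eq_st.
  by apply/eqP/enum_val_inj/ffunP.
by rewrite (bigD1 i) //= mxE (negPf si) mul0r.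
Qed.

Lemma tensor_scale L (c : 'I_L -> C) (A : 'I_L -> 'M[C]_2) :
  tensor_mx (fun i => c i *: A i) = (\prod_i c i) *: tensor_mx A.
Proof.
by apply/matrixP => s t; rewrite !mxE -big_split; apply: eq_bigr => i _; rewrite mxE.
Qed.

Lemma trace_tensor L (A : 'I_L -> 'M[C]_2) : \tr (tensor_mx A) = \prod_i \tr (A i).
Proof.
rewrite /mxtrace bigA_distr_bigA /= -sum_bits.
by apply: eq_bigr => s _; rewrite mxE.
Qed.

Lemma tensor_sum L (A : 'I_L -> 'F_2 -> 'M[C]_2) :
  tensor_mx (fun i => \sum_b A i b) =
  \sum_(u : 'rV['F_2]_L) tensor_mx (fun i => A i (u 0 i)).
Proof.
apply/matrixP => s t; rewrite !mxE summxE.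
under eq_bigr do rewrite summxE.
rewrite bigA_distr_bigA (reindex (fun u : 'rV['F_2]_L => [ffun i => u 0 i])) /=.
  by apply: eq_bigr => u _; rewrite mxE; apply: eq_bigr => i _; rewrite ffunE.
exists (fun f : {ffun 'I_L -> 'F_2} => \row_i f i) => [u _|f _].
  by apply/rowP => i; rewrite mxE ffunE.
by apply/ffunP => i; rewrite ffunE mxE.
Qed.

End Tensor.

Lemma tensor_trmxC (C : numClosedFieldType) L (A : 'I_L -> 'M[C]_2) :
  (tensor_mx A)^t* = tensor_mx (fun i => (A i)^t*).
Proof.
apply/matrixP => s t; rewrite !mxE rmorph_prod.
by apply: eq_bigr => i _; rewrite !mxE.
Qed.

Lemma tensor_cv_outer (C : numClosedFieldType) L (v : 'I_L -> 'cV[C]_2) :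
  tensor_cv v *m map_mx Num.conj (tensor_cv v)^T =
  tensor_mx (fun i => v i *m map_mx Num.conj (v i)^T).
Proof.
apply/matrixP => s t; rewrite !mxE big_ord1 !mxE rmorph_prod -big_split.
by apply: eq_bigr => i _; rewrite !mxE big_ord1 !mxE.
Qed.

(** * The Pauli group, one site at a time and up to scalars *)

Section Pauli.
Local Open Scope complex_scope.
Variable R : realType.
Local Notation C := R[i].

Lemma eq_mx2 (A B : 'M[C]_2) :
  A 0 0 = B 0 0 -> A 0 1 = B 0 1 -> A 1 0 = B 1 0 -> A 1 1 = B 1 1 -> A = B.
Proof.
move=> ? ? ? ?; apply/matrixP => i j.
(* ['F_2] and ['I_2] are convertible, so the case analysis on F_2 applies to matrix indices. *)
by case: (F2_cases i) => ->; case: (F2_cases j) => ->.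
Qed.

Lemma mulmx2E m n (A : 'M[C]_(m, 2)) (B : 'M[C]_(2, n)) i j :
  (A *m B) i j = A i 0 * B 0 j + A i 1 * B 1 j.
Proof.
rewrite mxE big_ord_recl big_ord1; congr (_ + A i _ * B _ j); exact: val_inj.
Qed.

Lemma i_sqr : 'i * 'i = -1 :> C.
Proof. by apply/eqP; rewrite eq_complex /= !mul0r !mulr0 mul1r sub0r addr0 oppr0 !eqxx. Qed.

Lemma conj_i : Num.conj ('i : C) = - 'i.
Proof. by apply/eqP; rewrite eq_complex /= oppr0 !eqxx. Qed.

Definition letter_mx (l : option axis) : 'M[C]_2 := oapp (sigma R) 1%:M l.

Definition letter_mul (a b : option axis) : option axis :=
  match a, b with
  | None, c | c, None => c
  | Some AX, Some AX | Some AY, Some AY | Some AZ, Some AZ => None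
  | Some AX, Some AY | Some AY, Some AX => Some AZ
  | Some AY, Some AZ | Some AZ, Some AY => Some AX
  | Some AZ, Some AX | Some AX, Some AZ => Some AY
  end.

Definition letter_phase (a b : option axis) : C :=
  match a, b with
  | Some AX, Some AY | Some AY, Some AZ | Some AZ, Some AX => 'i
  | Some AY, Some AX | Some AZ, Some AY | Some AX, Some AZ => - 'i
  | _, _ => 1
  end.

Definition letter_anti (a b : option axis) : 'F_2 :=
  match a, b with
  | None, _ | _, None => 0
  | Some AX, Some AX | Some AY, Some AY | Some AZ, Some AZ => 0
  | _, _ => 1
  end.

Local Ltac pauli_simpl := rewrite ?(mulr0, mul0r, mulr1, mul1r, addr0, add0r,
  mulrN, mulNr, opprK, oppr0, i_sqr, expr0, expr1).

Lemma letter_mulE a b :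
  letter_mx a *m letter_mx b = letter_phase a b *: letter_mx (letter_mul a b).
Proof.
case: a b => [[]|] [[]|]; rewrite /letter_mx /= ?mul1mx ?mulmx1 ?scale1r //;
  by apply: eq_mx2; rewrite mulmx2E !mxE /=; pauli_simpl.
Qed.

Lemma letter_phase_neq0 a b : letter_phase a b != 0.
Proof.
have i_neq0 : 'i != 0 :> C by apply/eqP => /(congr1 (@complex.Im R)) /eqP; rewrite oner_eq0.
by case: a b => [[]|] [[]|] /=; rewrite ?oppr_eq0 ?oner_eq0.
Qed.

Lemma letter_mulC a b : letter_mx a *m letter_mx b =
  sgn (letter_anti a b) *: (letter_mx b *m letter_mx a).
Proof.
rewrite !letter_mulE scalerA.
by case: a b => [[]|] [[]|] /=; rewrite /sgn /=; pauli_simpl.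
Qed.

Lemma letter_sqr a : letter_mx a *m letter_mx a = 1%:M.
Proof. by rewrite letter_mulE; case: a => [[]|] /=; rewrite scale1r. Qed.

Lemma letter_herm a : (letter_mx a)^t* = letter_mx a.
Proof.
case: a => [a|]; last by rewrite /= trmx1 map_mx1.
by case: a; apply: eq_mx2; 
  rewrite !mxE /= ?expr1 ?rmorphN ?rmorph0 ?rmorph1 /= ?conj_i ?opprK.
Qed.

Lemma trace_letter a : \tr (letter_mx a) = if a is Some _ then 0 else 2.
Proof.
case: a => [a|]; last exact: mxtrace1.
rewrite /mxtrace big_ord_recl big_ord1.
by case: a; rewrite !mxE /=; pauli_simpl; rewrite ?subrr.
Qed.

(** Any nonzero scalar is allowed instead of a phase: closure under products and the vanishing of
    traces are all that is asked of it. *)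
Definition is_pauli L (X : 'M[C]_(qdim L)) : Prop :=
  exists (c : C) (l : 'I_L -> option axis),
    c != 0 /\ X = c *: tensor_mx (fun i => letter_mx (l i)).

Lemma pauli_mul L (X Y : 'M[C]_(qdim L)) : is_pauli X -> is_pauli Y -> is_pauli (X *m Y).
Proof.
move=> [c [l [c0 ->]]] [e [k [e0 ->]]].
exists (c * e * \prod_i letter_phase (l i) (k i)), (fun i => letter_mul (l i) (k i)).
split; first by rewrite !mulf_neq0 //; apply/prodf_neq0 => i _; exact: letter_phase_neq0.
rewrite -scalemxAl -scalemxAr tensor_mulmx scalerA -[RHS]scalerA; congr (_ *: _).
by rewrite -tensor_scale; apply: eq_tensor_mx => i; exact: letter_mulE.
Qed.

Lemma pauli1 L : is_pauli (1%:M : 'M[C]_(qdim L)).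
Proof. by exists 1, (fun=> None); rewrite oner_neq0 scale1r tensor_mx1. Qed.

(** The trace is a product over sites and X, Y, Z are traceless, so a nonzero trace leaves only
    identity letters. *)
Lemma pauli_trace_scalar L (X : 'M[C]_(qdim L)) :
  is_pauli X -> \tr X != 0 -> exists c : C, X = c%:M.
Proof.
move=> [c [l [_ ->]]]; rewrite linearZ /= trace_tensor mulf_eq0 negb_or => /andP[_].
move=> /prodf_neq0 tr0; exists c; rewrite -scalemx1 -(tensor_mx1 C L).
congr (_ *: _); apply: eq_tensor_mx => i; move: (tr0 i isT).
by rewrite trace_letter; case: (l i) => //=; rewrite eqxx.
Qed.

End Pauli.

(** * Local Pauli strings and dephasing *)

Section LocalRep.
Variables (R : realType) (L : nat) (D : 'I_L -> axis).
Local Notation C := R[i].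

Definition basis_letter (u : 'rV['F_2]_L) (i : 'I_L) : option axis :=
  if u 0 i == 0 then None else Some (D i).

Definition local_rep (u : 'rV['F_2]_L) : 'M[C]_(qdim L) :=
  tensor_mx (fun i => letter_mx R (basis_letter u i)).

Lemma basis_letterD u v i : letter_mx R (basis_letter (u + v) i) =
  letter_mx R (basis_letter u i) *m letter_mx R (basis_letter v i).
Proof.
rewrite /basis_letter !mxE; case: (F2_cases (u 0 i)) => ->; case: (F2_cases (v 0 i)) => ->;
  by rewrite ?F2_addrr ?addr0 ?add0r ?eqxx ?oner_eq0 ?letter_sqr ?mulmx1 ?mul1mx.
Qed.

Lemma local_rep_involutive : involutive_rep local_rep.
Proof.
split=> [|u v|u].
- rewrite /local_rep -(tensor_mx1 C L); apply: eq_tensor_mx => i.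
  by rewrite /basis_letter mxE eqxx.
- by rewrite /local_rep tensor_mulmx; apply: eq_tensor_mx => i; exact: basis_letterD.
- by rewrite /local_rep tensor_trmxC; apply: eq_tensor_mx => i; exact: letter_herm.
Qed.

Lemma local_rep_pauli u : is_pauli (local_rep u).
Proof. by exists 1, (basis_letter u); rewrite oner_neq0 scale1r. Qed.

Lemma trace_local_rep u : \tr (local_rep u) != 0 -> u = 0.
Proof.
rewrite trace_tensor => /prodf_neq0 tr0; apply/rowP => i; rewrite mxE.
have := tr0 i isT; rewrite trace_letter /basis_letter.
by case: (u 0 i =P 0) => //= _; rewrite eqxx.
Qed.

Lemma site_pauli_local_rep i : site_pauli R (i, D i) = local_rep (delta_mx 0 i).
Proof.
apply: eq_tensor_mx => j; rewrite /basis_letter mxE eqxx /=.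
by case: eqP => [->|_]; rewrite ?oner_eq0 ?eqxx.
Qed.

(** This is the eigenprojection [(1 + (-1)^alpha sigma) / 2], written as a Fourier sum over F_2 so
    that tensoring over the sites yields a sum over ['rV['F_2]_L]. *)
Lemma eigket_outer a alpha :
  eigket R a alpha *m map_mx Num.conj (eigket R a alpha)^T =
  2^-1 *: \sum_(b : 'F_2) (sgn (alpha%:R * b) *: letter_mx R (if b == 0 then None else Some a)).
Proof.
have half : (sqrtC 2)^-1 * ((sqrtC 2)^-1)^* = 2^-1 :> C.
  rewrite conj_Creal ?rpredV ?ger0_real ?sqrtC_ge0 ?ler0n //.
  by rewrite -invfM -expr2 sqrtCK.
have one_half : 1 = 2^-1 * (1 + 1) :> C by rewrite mulVf // pnatr_eq0.
have sgn_alpha : sgn (alpha%:R) = (-1) ^+ alpha :> C by case: alpha.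
rewrite big_ord_recl big_ord1 /= mulr0 sgn0 scale1r.
have -> : lift ord0 ord0 = 1 :> 'F_2 by exact: val_inj.
rewrite mulr1 sgn_alpha /letter_mx /=.
have halfM (x y : C) : (sqrtC 2)^-1 * x * ((sqrtC 2)^-1 * y)^* = 2^-1 * (x * y^*).
  by rewrite rmorphM mulrACA half.
case: a; apply: eq_mx2; rewrite mxE big_ord1 !mxE /=.
all: rewrite ?halfM; case: alpha {sgn_alpha}.
all: rewrite /= ?expr0 ?expr1 ?rmorphM ?rmorphN ?rmorph1 ?rmorph0 /= ?conj_i.
all: by rewrite ?(mulr1, mul1r, mulr0, mul0r, addr0, add0r, mulrN, mulNr, opprK, oppr0,
  i_sqr, subrr) -?one_half.
Qed.

Definition outcome_vec (s : {ffun 'I_L -> bool}) : 'rV['F_2]_L := \row_i (s i)%:R.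

Lemma basis_outer s : basis_ket R D s *m basis_bra R D s =
  2 ^- L *: \sum_u sgn ((outcome_vec s *m u^T) 0 0) *: local_rep u.
Proof.
rewrite tensor_cv_outer.
under eq_tensor_mx do rewrite eigket_outer.
rewrite tensor_scale prodr_const card_ord exprVn tensor_sum; congr (_ *: _).
apply: eq_bigr => u _; rewrite tensor_scale mxE sgn_sum; congr (_ *: _).
by apply: eq_bigr => i _; rewrite !mxE.
Qed.

Lemma sum_outcome_vec (F : 'rV['F_2]_L -> C) : \sum_s F (outcome_vec s) = \sum_y F y.
Proof.
rewrite [RHS](reindex outcome_vec) //.
exists (fun y : 'rV['F_2]_L => [ffun i => y 0 i != 0]) => [s _|y _].
  by apply/ffunP => i; rewrite ffunE mxE; case: (s i); rewrite ?oner_eq0 ?eqxx.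
by apply/rowP => i; rewrite mxE ffunE; case: (F2_cases (y 0 i)) => ->.
Qed.

(** Both projections around [X] are Fourier sums of local strings. Summing over the outcomes [s]
    cancels every cross term with u != v by orthogonality of characters. *)
Lemma diagonal_part_twirl (X : 'M[C]_(qdim L)) :
  diagonal_part D X = 2 ^- L *: \sum_u local_rep u *m X *m local_rep u.
Proof.
have outerE s :
    (basis_bra R D s *m X *m basis_ket R D s) 0 0 *: (basis_ket R D s *m basis_bra R D s) =
    (2 ^- L * 2 ^- L) *: \sum_u \sum_v sgn ((outcome_vec s *m (u + v)^T) 0 0) *:
        (local_rep u *m X *m local_rep v).
  (* The 1 x 1 coefficient becomes a matrix factor, which gives the sandwich of [X] between two
     copies of the projection onto [s]. *)
  rewrite scalemxAl -mul_mx_scalar -mx11_scalar.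
  rewrite !mulmxA -[_ *m X *m _ *m _]mulmxA basis_outer.
  rewrite -!scalemxAl -scalemxAr scalerA; congr (_ *: _).
  rewrite !mulmx_suml; apply: eq_bigr => u _.
  rewrite mulmx_sumr; apply: eq_bigr => v _.
  have -> : (outcome_vec s *m (u + v)^T) 0 0 =
      (outcome_vec s *m u^T) 0 0 + (outcome_vec s *m v^T) 0 0.
    by rewrite linearD mulmxDr mxE.
  by rewrite sgnD -!scalemxAl -scalemxAr scalerA.
rewrite /diagonal_part (eq_bigr _ (fun s _ => outerE s)) -scaler_sumr -scalerA.
congr (_ *: _); rewrite exchange_big scaler_sumr; apply: eq_bigr => u _.
rewrite exchange_big (bigD1 u) //= [X in _ + X]big1 => [|v neq_vu].
  rewrite addr0 -scaler_suml.
  rewrite (sum_outcome_vec (fun y => sgn ((y *m (u + u)^T) 0 0))).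
  rewrite sum_sgn rVF2_addrr trmx0 eqxx scalerA mulVf ?scale1r //.
  by rewrite expf_neq0 // pnatr_eq0.
rewrite -scaler_suml (sum_outcome_vec (fun y => sgn ((y *m (u + v)^T) 0 0))).
rewrite sum_sgn trmx_eq0 ifN ?scale0r //; apply: contraNneq neq_vu => uv0.
by rewrite -[v]add0r -(rVF2_addrr u) -addrA uv0 addr0.
Qed.

End LocalRep.

(** * Signed strings and the stabilizer group *)

Section PauliStrings.
Variables (R : realType) (L : nat).
Local Notation C := R[i].
Implicit Type h : pauli_string L.

Lemma string_pauli h : is_pauli (string_mx R h).
Proof. by exists ((-1) ^+ negative h), (letter h); rewrite signr_eq0. Qed.

Lemma string_sqr h : string_mx R h *m string_mx R h = 1%:M.
Proof.
rewrite /string_mx -scalemxAl -scalemxAr scalerA -expr2 sqrr_sign scale1r tensor_mulmx.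
by rewrite -(tensor_mx1 C L); apply: eq_tensor_mx => i; exact: letter_sqr.
Qed.

Lemma string_herm h : (string_mx R h)^t* = string_mx R h.
Proof.
rewrite /string_mx trmxC_scale rmorph_sign tensor_trmxC; congr (_ *: _).
by apply: eq_tensor_mx => i; exact: letter_herm.
Qed.

Lemma local_rep_string D u h : local_rep R D u *m string_mx R h =
  sgn (\sum_i u 0 i * letter_anti (Some (D i)) (letter h i)) *:
    (string_mx R h *m local_rep R D u).
Proof.
rewrite /string_mx -scalemxAr -scalemxAl [RHS]scalerA mulrC -scalerA; congr (_ *: _).
rewrite !tensor_mulmx sgn_sum -tensor_scale; apply: eq_tensor_mx => i.
rewrite -/(letter_mx R (letter h i)) letter_mulC; congr (sgn _ *: _).
by rewrite /basis_letter; case: (F2_cases (u 0 i)) => ->; rewrite ?mul0r ?mul1r ?eqxx ?oner_eq0.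
Qed.

End PauliStrings.

Section StabilizerGroup.
Variables (R : realType) (L n : nat) (g : 'I_n -> pauli_string L).
Hypothesis g_stab : stabilizer_generators R g.
Local Notation C := R[i].

Definition stab_rep (v : 'rV['F_2]_n) : 'M[C]_(qdim L) :=
  monomial (fun j => string_mx R (g j)) v.

Let gC i j : GRing.comm (string_mx R (g i)) (string_mx R (g j)).
Proof. by have [gC _ _] := g_stab; rewrite /GRing.comm -!mulmxE; exact: gC. Qed.

Lemma prod_herm (I : Type) (r : seq I) (F : I -> 'M[C]_(qdim L)) :
    (forall i, (F i)^t* = F i) -> (forall i j, GRing.comm (F i) (F j)) ->
  (\prod_(i <- r) F i)^t* = \prod_(i <- r) F i.
Proof.
move=> F_herm FC; elim: r => [|i r IHr].
  by rewrite big_nil trmx1 map_mx1.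
by rewrite big_cons trmxC_mul IHr F_herm; apply/commr_sym/commr_prod.
Qed.

Lemma stab_rep_involutive : involutive_rep stab_rep.
Proof.
split; first exact: monomial0.
  by apply: monomialD => // i; exact: string_sqr.
move=> v; apply: prod_herm => [i|i j].
  by case: (F2_cases (v 0 i)) => ->; rewrite ?trmx1 ?map_mx1 ?string_herm.
exact/commrX/commr_sym/commrX/gC.
Qed.

Lemma stab_rep_delta j : stab_rep (delta_mx 0 j) = string_mx R (g j).
Proof.
rewrite /stab_rep /monomial -[RHS](big_pred1_eq *%R j (fun i => string_mx R (g i))).
rewrite [RHS]big_mkcond; apply: eq_bigr => i _; rewrite mxE eqxx /=.
by case: (i == j).
Qed.

Lemma stab_rep_pauli v : is_pauli (stab_rep v).
Proof.
rewrite /stab_rep /monomial; apply: big_ind => [|X Y|i _]; first exact: pauli1.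
  exact: pauli_mul.
by case: (F2_cases (v 0 i)) => ->; [exact: pauli1 | exact: string_pauli].
Qed.

Definition anticommutation (D : 'I_L -> axis) : 'M['F_2]_(L, n) :=
  \matrix_(i, j) letter_anti (Some (D i)) (letter (g j) i).

Lemma local_rep_stab_rep D u v : local_rep R D u *m stab_rep v =
  sgn ((u *m anticommutation D *m v^T) 0 0) *: (stab_rep v *m local_rep R D u).
Proof.
set B := anticommutation D.
have expE j : local_rep R D u *m string_mx R (g j) ^+ v 0 j =
    sgn ((u *m B) 0 j * v 0 j) *: (string_mx R (g j) ^+ v 0 j *m local_rep R D u).
  case: (F2_cases (v 0 j)) => ->; first by rewrite mulr0 sgn0 scale1r mulmx1 mul1mx.
  rewrite mulr1 local_rep_string mxE; congr (sgn _ *: _).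
  by apply: eq_bigr => i _; rewrite mxE.
rewrite mxE sgn_sum /stab_rep /monomial.
under [X in X *: _]eq_bigr do rewrite [v^T _ _]mxE.
elim: (index_enum _) => [|j r IHr].
  by rewrite !big_nil scale1r mulmx1 mul1mx.
have mulE (X Y : 'M[C]_(qdim L)) : X * Y = X *m Y by [].
rewrite !big_cons !mulE.
rewrite mulmxA expE -scalemxAl -mulmxA IHr -scalemxAr scalerA.
by rewrite mulmxA.
Qed.

Lemma generated_stab_rep (G : 'M[C]_(qdim L) -> Prop) (v : 'rV['F_2]_n) :
  (forall j, v 0 j != 0 -> G (string_mx R (g j))) -> generated G (stab_rep v).
Proof.
move=> vG; rewrite /stab_rep /monomial; apply: big_ind => [|X Y|j _].
- exact: generated_one.
- exact: generated_mul.
case: (F2_cases (v 0 j)) (vG j) => -> Gj; first exact: generated_one.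
by rewrite expr1; apply/generated_mem/Gj; rewrite oner_eq0.
Qed.

(** A nonzero trace would make [g_v] a scalar of square 1. The value -1 is excluded from the group,
    and the value 1 would write some generator as a product of the others. *)
Lemma trace_stab_rep v : v != 0 -> \tr (stab_rep v) = 0.
Proof.
move=> v0; apply/eqP/negPn/negP => /(pauli_trace_scalar (stab_rep_pauli v))[c cE].
have [_ g_indep g_neg1] := g_stab.
have [e eE] : exists b : bool, stab_rep v = (-1) ^+ b *: 1%:M.
  have sqr1 := rep_mulmx_self stab_rep_involutive v.
  case: (eqVneq (1%:M : 'M[C]_(qdim L)) 0) => [one0|one0].
    by exists false; rewrite -[stab_rep v]mul1mx one0 mul0mx scaler0.
  have /eqP : (c ^+ 2 - 1) *: 1%:M = 0 :> 'M[C]_(qdim L).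
    by rewrite scalerBl scale1r scalemx1 -sqr1 cE -scalar_mxM subrr.
  rewrite scaler_eq0 (negPf one0) orbF subr_eq0.
  rewrite sqrf_eq1 => /orP[] /eqP cE'; rewrite cE cE'.
    by exists false; rewrite scale1r.
  by exists true; rewrite expr1 scalemx1.
have /rV0Pn[j vj] := v0; case: e eE => eE.
  apply: g_neg1; rewrite -scaleN1r -[-1]expr1 -eE.
  by apply: generated_stab_rep => k _; exists k.
apply: (g_indep j).
(* Since [g_v = 1], the generator [g_j] equals [g_(v + e_j)], and the coordinate j of [v + e_j] is 1
   + 1 = 0. *)
have -> : string_mx R (g j) = stab_rep (v + delta_mx 0 j).
  by rewrite (repD stab_rep_involutive) eE scale1r mul1mx stab_rep_delta.
apply: generated_stab_rep => k; rewrite !mxE eqxx /= => vk.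
exists k => //; apply: contraNneq vk => ->; rewrite eqxx.
by case: (F2_cases (v 0 j)) vj => ->; rewrite ?eqxx ?F2_addrr.
Qed.

Lemma trace_stab_average : \tr (average stab_rep) = 2 ^+ L / 2 ^+ n.
Proof.
rewrite /average linearZ linear_sum (bigD1 0) //= [X in _ + X]big1 ?addr0; last first.
  by move=> v; exact: trace_stab_rep.
rewrite (rep0 stab_rep_involutive) mxtrace1 /qdim card_ffun !card_ord natrX.
by rewrite mulrC.
Qed.

End StabilizerGroup.

(** * Sequential measurements as one group average *)

Section ProductAverages.
Variables (C : numClosedFieldType) (d : nat).

Lemma prod_average m (x : 'I_m -> 'M[C]_d) :
  \prod_(j < m) (2^-1 *: (1%:M + x j)) = average (monomial x).
Proof.
have enumE (F : 'I_m -> 'M[C]_d) : \prod_j F j = \prod_(j <- enum 'I_m) F j.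
  by rewrite [index_enum _]unlock enumT.
rewrite /average -prod1D_monomial !enumE -[in 2 ^- _](size_enum_ord m) -exprVn.
elim: (enum _) => [|j r IHr]; first by rewrite !big_nil scale1r.
have mulE (X Y : 'M[C]_d) : X * Y = X *m Y by [].
by rewrite !big_cons IHr exprS !mulE -scalemxAl -scalemxAr scalerA.
Qed.

Lemma monomial_rep m (h : 'rV['F_2]_m -> 'M[C]_d) : involutive_rep h ->
  monomial (fun k => h (delta_mx 0 k)) =1 h.
Proof.
move=> hR w; rewrite [in RHS](row_sum_delta w) (big_morph h (repD hR) (rep0 hR)).
apply: eq_bigr => k _; case: (F2_cases (w 0 k)) => ->.
  by rewrite scale0r (rep0 hR).
by rewrite scale1r.
Qed.

Lemma involution_proj_comm (A B : 'M[C]_d) : A *m B = B *m A ->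
  (2^-1 *: (1%:M + A)) *m (2^-1 *: (1%:M + B)) = (2^-1 *: (1%:M + B)) *m (2^-1 *: (1%:M + A)).
Proof.
move=> AB; rewrite -!scalemxAl -!scalemxAr; congr (_ *: (_ *: _)).
by rewrite !mulmxDl !mulmxDr !mulmx1 !mul1mx AB addrACA.
Qed.

Lemma involution_proj_idem (A : 'M[C]_d) : A *m A = 1%:M ->
  (2^-1 *: (1%:M + A)) *m (2^-1 *: (1%:M + A)) = 2^-1 *: (1%:M + A).
Proof.
move=> AA; rewrite -scalemxAl -scalemxAr; congr (_ *: _).
rewrite mulmxDl !mulmxDr mulmx1 mul1mx mulmx1 AA [A + 1%:M]addrC.
by rewrite -mulr2n -scaler_nat scalerA mulVf ?scale1r // pnatr_eq0.
Qed.

Lemma scale_comm (A B : 'M[C]_d) a b : A *m B = B *m A ->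
  (a *: A) *m (b *: B) = (b *: B) *m (a *: A).
Proof. by move=> AB; rewrite -!scalemxAl -!scalemxAr AB !scalerA mulrC. Qed.

Lemma sign_involution (A : 'M[C]_d) b : A *m A = 1%:M ->
  ((-1) ^+ b *: A) *m ((-1) ^+ b *: A) = 1%:M.
Proof.
by move=> AA; rewrite -scalemxAl -scalemxAr scalerA -expr2 sqrr_sign AA scale1r.
Qed.

Lemma sandwich_comm (A B X : 'M[C]_d) c : A *m B = B *m A ->
  B *m (c *: (A *m X *m A)) *m B = c *: (A *m B *m X *m (A *m B)).
Proof. by move=> AB; rewrite -scalemxAr -scalemxAl !mulmxA AB. Qed.

End ProductAverages.

Section LocalMeasurements.
Variables (R : realType) (L : nat) (D : 'I_L -> axis).
Local Notation C := R[i].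
Implicit Types (rho : 'M[C]_(qdim L)) (x : 'I_L * bool) (q : seq ('I_L * bool)).

Definition basis_proj x : 'M[C]_(qdim L) := outcome_proj R (x.1, D x.1) x.2.

Definition basis_record q : seq (('I_L * axis) * bool) :=
  [seq ((x.1, D x.1), x.2) | x <- q].

Definition record_proj q : 'M[C]_(qdim L) := \prod_(x <- q) basis_proj x.

Lemma basis_projE x :
  basis_proj x = 2^-1 *: (1%:M + (-1) ^+ x.2 *: local_rep R D (delta_mx 0 x.1)).
Proof. by rewrite /basis_proj /outcome_proj site_pauli_local_rep. Qed.

Lemma basis_proj_comm x y : basis_proj x *m basis_proj y = basis_proj y *m basis_proj x.
Proof.
rewrite !basis_projE; apply/involution_proj_comm/scale_comm.
exact: rep_comm (local_rep_involutive R D) _ _.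
Qed.

Lemma basis_proj_idem x : basis_proj x *m basis_proj x = basis_proj x.
Proof.
rewrite !basis_projE; apply/involution_proj_idem/sign_involution.
exact: rep_mulmx_self (local_rep_involutive R D) _.
Qed.

(** All projections are diagonal in the same basis, hence commute: the successive sandwiches merge
    into one and the normalizing probabilities telescope. *)
Lemma record_basisE rho q : \tr rho = 1 -> record_prob rho (basis_record q) != 0 ->
  record_prob rho (basis_record q) = \tr (record_proj q *m rho *m record_proj q) /\
  record_state rho (basis_record q) = (record_prob rho (basis_record q))^-1 *:
    (record_proj q *m rho *m record_proj q).
Proof.
rewrite /record_proj; elim: q rho => [|x q IHq] rho tr1 /=.
  by rewrite big_nil mul1mx mulmx1 tr1 invr1 scale1r.
rewrite -/(basis_proj x) big_cons mulf_eq0 negb_or => /andP[].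
have -> : outcome_prob rho (x.1, D x.1) x.2 = \tr (basis_proj x *m rho) by [].
set p := \tr (basis_proj x *m rho) => p_neq0.
have -> : post_state rho (x.1, D x.1) x.2 = p^-1 *: (basis_proj x *m rho *m basis_proj x) by [].
have Pi_comm : basis_proj x *m \prod_(y <- q) basis_proj y =
    (\prod_(y <- q) basis_proj y) *m basis_proj x.
  by apply: commr_prod => y _; exact: basis_proj_comm.
have mulE (X Y : 'M[C]_(qdim L)) : X * Y = X *m Y by [].
move: IHq Pi_comm; rewrite mulE; set Pi := \prod_(y <- q) _ => IHq Pi_comm prob_neq0.
have [|probE stateE] := IHq _ _ prob_neq0.
  (* The normalized state after one measurement has trace one again, as the induction requires. *)
  by rewrite linearZ /= mxtrace_mulC mulmxA basis_proj_idem mulVf.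
move: probE stateE; rewrite sandwich_comm // mxtraceZ.
set r := record_prob _ _ => rE ->; split; first by rewrite rE mulrA divff ?mul1r.
by rewrite scalerA -invfM [r * p]mulrC.
Qed.

Section MeasuredRep.
Variables (M : nat) (t : 'I_M -> 'I_L) (o : 'I_M -> bool).

(** The sites [t k] may repeat, in which case their letters cancel mod 2. Contradictory outcomes at
    a repeated site make the average vanish, and such a record has probability 0. *)
Definition measured_rep (w : 'rV['F_2]_M) : 'M[C]_(qdim L) :=
  sgn (\sum_k w 0 k * (o k)%:R) *: local_rep R D (w *m rowsub t 1%:M).

Lemma measured_rep_involutive : involutive_rep measured_rep.
Proof.
have locR := local_rep_involutive R D.
split=> [|u v|u]; rewrite /measured_rep.
- rewrite big1 => [|k _]; last by rewrite mxE mul0r.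
  by rewrite sgn0 scale1r mul0mx (rep0 locR).
- rewrite mulmxDl (repD locR) -scalemxAl -scalemxAr scalerA -sgnD -big_split.
  by congr (sgn _ *: _); apply: eq_bigr => k _; rewrite mxE mulrDl.
- by rewrite trmxC_scale rmorph_sign (rep_herm locR).
Qed.

Lemma measured_rep_delta k :
  measured_rep (delta_mx 0 k) = (-1) ^+ o k *: local_rep R D (delta_mx 0 (t k)).
Proof.
rewrite /measured_rep -rowE row_rowsub row1 (bigD1 k) //= big1 => [|j neq_jk].
  by rewrite addr0 mxE !eqxx mul1r; case: (o k).
by rewrite mxE (negPf neq_jk) andbF mul0r.
Qed.

Lemma record_proj_average :
  record_proj [seq (t k, o k) | k <- enum 'I_M] = average measured_rep.
Proof.
transitivity (average (monomial (fun k => measured_rep (delta_mx 0 k)))).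
  rewrite -prod_average /record_proj big_map.
  rewrite [index_enum _]unlock -enumT; apply: eq_bigr => k _.
  by rewrite basis_projE measured_rep_delta.
congr (_ *: _); apply: eq_bigr => w _.
exact: monomial_rep measured_rep_involutive w.
Qed.

Lemma zip_basis_record (outcomes : M.-tuple bool) : o =1 tnth outcomes ->
  zip [tuple (t k, D (t k)) | k < M] outcomes =
  basis_record [seq (t k, o k) | k <- enum 'I_M].
Proof.
move=> oE; rewrite /basis_record -map_comp -[in LHS](map_tnth_enum outcomes).
by rewrite /= zip_map; apply: eq_map => k /=; rewrite oE.
Qed.

End MeasuredRep.

End LocalMeasurements.

(** * Coherence as the rank of the commutation matrix *)

Section CoherenceOfStabilizer.

Lemma rep_subgroup_sum_sqr (C : numClosedFieldType) d m
    (h : 'rV['F_2]_m -> 'M[C]_d) (K : pred 'rV['F_2]_m) :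
    involutive_rep h -> (forall u v, K u -> K (u + v) = K v) ->
  (\sum_(v | K v) h v) *m (\sum_(v | K v) h v) = #|K|%:R *: \sum_(v | K v) h v.
Proof.
move=> hR KD; rewrite {1}mulmx_suml -sum1_card natr_sum scaler_suml.
apply: eq_bigr => u Ku; rewrite scale1r mulmx_sumr.
rewrite [RHS](reindex_inj (addrI u)) /=.
by apply: eq_big => [v|v _]; [rewrite KD | rewrite repD].
Qed.

Lemma log2_pow (R : realType) k : log2 (complex.Re (2 ^- k : R[i])) = - k%:R.
Proof.
have -> : 2 ^- k = ((2 ^- k : R)%:C)%C by rewrite fmorphV rmorphXn rmorph_nat.
rewrite /= /log2 lnV ?posrE ?exprn_gt0 // lnXn // mulNr -[ln _ *+ k]mulr_natl mulfK //.
by rewrite gt_eqF // ln_gt0 // ltr1n.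
Qed.

Variables (R : realType) (L n : nat) (g : 'I_n -> pauli_string L).
Hypothesis g_stab : stabilizer_generators R g.
Variable D : 'I_L -> axis.
Local Notation C := R[i].
Local Notation G := (stab_rep R g).
Local Notation A := (local_rep R D).
Local Notation P := (average G).
Local Notation B := (anticommutation g D).
Local Notation K := [pred v : 'rV['F_2]_n | B *m v^T == 0].

Let two_neq0 k : 2 ^+ k != 0 :> C.
Proof. by rewrite expf_neq0 // pnatr_eq0. Qed.

Lemma card_commuting : #|K| = (2 ^ (n - \rank B))%N.
Proof.
rewrite -(mxrank_tr B) -card_ker_F2; apply: eq_card => v; rewrite !inE.
by rewrite -trmx_eq0 trmx_mul trmxK.
Qed.

Lemma stab_state_entropy k : \tr P = 2 ^+ k -> vn_entropy (2 ^- k *: P) = k%:R.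
Proof.
move=> trP; rewrite (@vn_entropy_flat _ _ _ (2 ^- k)).
- by rewrite log2_pow mxtraceZ trP mulVf //= mulr1 opprK.
- by rewrite trmxC_scale fmorphV rmorphXn /= conjC_nat (average_herm (stab_rep_involutive g_stab)).
- by rewrite -scalemxAl -scalemxAr (average_idem (stab_rep_involutive g_stab)).
Qed.

(** Dephasing leaves [2^-L] times the sum over the subgroup [K] of order [2^(n - c)], with
    [c = \rank B]. That state is flat with eigenvalue [2^(n - c - L) = 2^-(k + c)], so its entropy
    is [k + c] against [k] for the original state. *)
Lemma stab_state_coherence k : (k + n)%N = L -> coherence D (2 ^- k *: P) = (\rank B)%:R.
Proof.
move=> kL; have GR := stab_rep_involutive g_stab.
have trP : \tr P = 2 ^+ k.
  by rewrite trace_stab_average // -kL exprD mulfK.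
rewrite /coherence (stab_state_entropy trP) diagonal_part_twirl.
set S := \sum_(v | B *m v^T == 0) G v.
have -> : 2 ^- L *: \sum_u A u *m (2 ^- k *: P) *m A u = 2 ^- L *: S.
  under eq_bigr do rewrite -scalemxAr -scalemxAl.
  rewrite -scaler_sumr (twirl_average (local_rep_involutive R D) (@local_rep_stab_rep R L n g D)).
  rewrite !scalerA; congr (_ *: _).
  have -> : 2 ^+ L = 2 ^+ k * 2 ^+ n :> C by rewrite -exprD kL.
  by rewrite mulfK // -mulrA mulVf // mulr1.
have trS : \tr S = 2 ^+ L.
  rewrite /S linear_sum (bigD1 0) /=; last by rewrite trmx0 mulmx0.
  rewrite big1 => [|v /andP[_]]; last exact: trace_stab_rep.
  by rewrite addr0 (rep0 GR) mxtrace1 /qdim card_ffun !card_ord natrX.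
have c_le : (\rank B <= n)%N by exact: rank_leq_col.
rewrite (@vn_entropy_flat _ _ _ (2 ^- (k + \rank B))).
- rewrite log2_pow mxtraceZ trS mulVf //= mulr1 opprK natrD.
  by rewrite addrAC subrr add0r.
- rewrite trmxC_scale fmorphV rmorphXn /= conjC_nat trmxC_sum.
  by congr (_ *: _); apply: eq_bigr => v _; rewrite (rep_herm GR).
rewrite -scalemxAl -scalemxAr (rep_subgroup_sum_sqr (K := K) GR) => [|u v /eqP Bu0].
  rewrite card_commuting !scalerA; congr (_ *: _); rewrite [RHS]mulrC -mulrA; congr (_ * _).
  have -> : 2 ^+ L = 2 ^+ (k + \rank B) * 2 ^+ (n - \rank B) :> C.
    by rewrite -exprD -addnA subnKC // kL.
  by rewrite natrX invfM -mulrA mulVf ?mulr1.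
by rewrite /= linearD mulmxDr Bu0 add0r.
Qed.

End CoherenceOfStabilizer.

(** * A commuting local string outside the stabilizer group up to sign *)

Section UnstabilizedWitness.
Variables (R : realType) (L n : nat) (g : 'I_n -> pauli_string L).
Hypothesis g_stab : stabilizer_generators R g.
Variable D : 'I_L -> axis.
Local Notation C := R[i].
Local Notation G := (stab_rep R g).
Local Notation A := (local_rep R D).
Local Notation P := (average G).
Local Notation B := (anticommutation g D).

Definition stabilized (u : 'rV['F_2]_L) : bool :=
  (A u *m P == P) || (A u *m P == - P).

Lemma stabilized0 : stabilized 0.
Proof. by rewrite /stabilized (rep0 (local_rep_involutive R D)) mul1mx eqxx. Qed.

Lemma stabilizedD u v : stabilized u -> stabilized v -> stabilized (u + v).
Proof.
rewrite /stabilized (repD (local_rep_involutive R D)) -[A u *m A v *m P]mulmxA => uP.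
case/orP => /eqP ->; first exact: uP.
by rewrite mulmxN eqr_opp eqr_oppLR orbC.
Qed.

(** Conjugation by the local string at site [i] preserves the trace and fixes [A u], but multiplies
    [G v] by the sign of coordinate [i] of [B v^T]. A nonzero trace forces each sign to be 1. *)
Lemma trace_overlap_comm u v : \tr (A u *m G v) != 0 -> B *m v^T = 0.
Proof.
have AR := local_rep_involutive R D.
move=> tr_neq0; apply/colP => i; rewrite [RHS]mxE.
have : \tr (A u *m G v) = sgn ((B *m v^T) i 0) * \tr (A u *m G v).
  rewrite -{1}[A u]mulmx1 -(rep_mulmx_self AR (delta_mx 0 i)).
  rewrite mulmxA -mulmxA (local_rep_stab_rep R g) -scalemxAr mxtraceZ; congr (sgn _ * _).
    by rewrite -rowE -row_mul mxE.
  rewrite (rep_comm AR u) -mulmxA mxtrace_mulC -!mulmxA.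
  by rewrite (rep_mulmx_self AR) mulmx1.
case: (F2_cases ((B *m v^T) i 0)) => // ->; rewrite /sgn expr1 mulN1r => /esym/eqP.
by rewrite eqNr (negPf tr_neq0).
Qed.

(** Both local strings are nonzero multiples of the same [G v], so their product has nonzero trace
    and must be the identity string. *)
Lemma trace_overlap_inj u u' v :
  \tr (A u *m G v) != 0 -> \tr (A u' *m G v) != 0 -> u = u'.
Proof.
have AR := local_rep_involutive R D; have GR := stab_rep_involutive g_stab.
have scalar w : \tr (A w *m G v) != 0 -> exists2 c, c != 0 & A w = c *: G v.
  move=> tr_neq0; have [|c cE] := pauli_trace_scalar _ tr_neq0.
    exact: pauli_mul (local_rep_pauli R D w) (stab_rep_pauli R g v).
  exists c; first by apply: contraNneq tr_neq0 => c0; rewrite cE c0 raddf0 mxtrace0.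
  by rewrite -[A w]mulmx1 -(rep_mulmx_self GR v) mulmxA cE mul_scalar_mx.
move=> tr_u tr_u'; have [c c0 uE] := scalar u tr_u; have [c' c'0 u'E] := scalar u' tr_u'.
suff : u + u' = 0 by move=> uu'0; rewrite -[u']add0r -(rVF2_addrr u) -addrA uu'0 addr0.
apply: (@trace_local_rep R _ D); rewrite (repD AR) u'E -scalemxAr mxtraceZ.
exact: mulf_neq0 c'0 tr_u.
Qed.

(* Otherwise every u in ker B overlaps some g_v with B v^T = 0, injectively, so
   2^(L - c) <= 2^(n - c). *)
Lemma unstabilized_exists : (n < L)%N -> exists2 u, u *m B = 0 & ~~ stabilized u.
Proof.
move=> lt_nL; have [u /andP[/eqP uB uP]|all_stab] :=
  pickP [pred u | (u *m B == 0) && ~~ stabilized u]; first by exists u.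
pose overlap u := [pick v | \tr (A u *m G v) != 0].
have overlapP u : u *m B == 0 -> exists2 v, overlap u = Some v & \tr (A u *m G v) != 0.
  move=> uB; rewrite /overlap; case: pickP => [v tr_v|no_v]; first by exists v.
  (* If [u] overlapped no [v], then [tr (A u P)] would vanish, while it equals plus or minus
     [tr P]. *)
  have trP : \tr P != 0 by rewrite trace_stab_average // mulf_neq0 ?invr_eq0 ?expf_neq0 ?pnatr_eq0.
  have tr0 : \tr (A u *m P) = 0.
    rewrite /average -scalemxAr mxtraceZ mulmx_sumr raddf_sum /=.
    by rewrite big1 ?mulr0 // => v _; apply/eqP/negPn; rewrite no_v.
  have := all_stab u; rewrite /= uB /= => /negbFE /orP[] /eqP AP.
    by rewrite -AP tr0 eqxx in trP.
  by rewrite -[P]opprK -AP raddfN /= tr0 oppr0 eqxx in trP.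
have : (#|[pred u : 'rV_L | u *m B == 0%R]| <= #|[pred v : 'rV_n | B *m v^T == 0%R]|)%N.
  pose f u := odflt 0 (overlap u).
  have f_inj : {in [pred u : 'rV_L | u *m B == 0%R] &, injective f}.
    move=> u u' /overlapP[v fu tr_v] /overlapP[v' fu' tr_v'].
    rewrite /f fu fu' /= => vv'; rewrite -vv' in tr_v'; exact: trace_overlap_inj tr_v tr_v'.
  rewrite -(card_in_imset f_inj); apply/subset_leq_card/subsetP => _ /imsetP[u uB ->].
  by have [v fu tr_v] := overlapP u uB; rewrite inE /f fu /=; apply/eqP/trace_overlap_comm/tr_v.
(* Since [\rank B <= n], the truncated difference [n - \rank B] is a true one and comparing
   exponents gives [L <= n]. *)
rewrite card_ker_F2 card_commuting (leq_exp2l _ _ (ltnSn 1)).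
by rewrite (leq_sub2rE _ (rank_leq_col B)) leqNgt lt_nL.
Qed.

End UnstabilizedWitness.

(** * The strict drop of entropy *)

Section EntropyDrop.
Variables (C : numClosedFieldType) (d m n : nat).
Variables (a : 'rV['F_2]_m -> 'M[C]_d) (g : 'rV['F_2]_n -> 'M[C]_d) (B : 'M['F_2]_(m, n)).
Hypothesis aR : involutive_rep a.
Hypothesis gR : involutive_rep g.
Hypothesis ag : forall u v,
  a u *m g v = sgn ((u *m B *m v^T) 0 0) *: (g v *m a u).
Variables (l : C) (w : 'rV['F_2]_m).
Hypotheses (l_gt0 : 0 < l) (tr1 : \tr (l *: average g) = 1).
Hypotheses (wB : w *m B = 0) (awP : a w *m average g != average g).
Local Notation post := (average a *m (l *: average g) *m average a).
Hypothesis p_gt0 : 0 < \tr post.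

(** With [p = tr post], squaring gives [post^2 = l mu post], so the new eigenvalue is [l mu / p].
    The strict trace bound and [l tr P = 1] give [p < mu]. *)
Lemma post_state_flat : exists l' : C, [/\ l < l',
  ((\tr post)^-1 *: post)^t* = (\tr post)^-1 *: post &
  ((\tr post)^-1 *: post) *m ((\tr post)^-1 *: post) = l' *: ((\tr post)^-1 *: post)].
Proof.
set mu : C := 2 ^- m * #|[pred u : 'rV_m | u *m B == 0]|%:R.
have postE : post = l *: (average a *m average g *m average a).
  by rewrite -[average a *m (l *: _)]scalemxAr -[(l *: _) *m average a]scalemxAl.
have trE : \tr post = l * \tr (average a *m average g).
  rewrite postE mxtraceZ mxtrace_mulC.
  by rewrite [average a *m (average a *m _)]mulmxA (average_idem aR).
have p_lt : \tr post < mu.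
  rewrite trE -[mu]mulr1 -tr1 mxtraceZ mulrCA ltr_pM2l //.
  by apply: (trace_measured_average_lt aR gR ag _ awP); rewrite inE wB.
have post_sqr : post *m post = (l * mu) *: post.
  rewrite postE -[(l *: _) *m _]scalemxAl -[_ *m (l *: _)]scalemxAr.
  rewrite (measured_average_sqr aR gR ag) -/mu.
  by rewrite !scalerA; congr (_ *: _); rewrite [RHS]mulrAC mulrA.
have post_herm : post^t* = post.
  rewrite postE trmxC_scale !trmxC_mul (average_herm aR) (average_herm gR) mulmxA.
  by rewrite conj_Creal // ger0_real // ltW.
move: p_lt post_sqr post_herm p_gt0; set p := \tr post; set X := post.
move=> p_lt X_sqr X_herm p0; exists (l * mu / p); split.
- by rewrite -mulrA ltr_pMr // ltr_pdivlMr ?mul1r.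
- by rewrite trmxC_scale X_herm conj_Creal // rpredV ger0_real // ltW.
rewrite -[(p^-1 *: X) *m _]scalemxAl -[X *m (_ *: X)]scalemxAr X_sqr !scalerA.
by congr (_ *: _); rewrite [LHS]mulrC mulrA.
Qed.

End EntropyDrop.

Lemma flat_entropy_lt (R : realType) d (X Y : 'M[R[i]]_d) (x y : R[i]) :
    X^t* = X -> X *m X = x *: X -> \tr X = 1 ->
    Y^t* = Y -> Y *m Y = y *: Y -> \tr Y = 1 ->
  0 < x -> x < y -> vn_entropy Y < vn_entropy X.
Proof.
move=> X_herm XX trX Y_herm YY trY x_gt0 xy.
rewrite (vn_entropy_flat X_herm XX) (vn_entropy_flat Y_herm YY) trX trY /= !mulr1.
(* The order on [R[i]] relates only numbers with equal imaginary parts, so these inequalities pass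
   to the real parts. *)
move: x_gt0 xy; rewrite !ltcE /= => /andP[_ x_gt0] /andP[_ xy].
rewrite ltrN2 /log2 ltr_pM2r ?invr_gt0 ?ln_gt0 ?ltr1n //.
by rewrite ltr_ln // posrE // (lt_trans x_gt0).
Qed.

Theorem theorem2 (R : realType) (L : nat) (D : 'I_L -> axis)
    (rho : 'M[R[i]]_(qdim L)) (M : nat)
    (rho_stab : is_stabilizer_state rho)
    (rho_mixed : 0 < vn_entropy rho)
    (M_gt : coherence D rho < M%:R) :
  exists ms : M.-tuple ('I_L * axis),
    forall outcomes : M.-tuple bool,
      0 < record_prob rho (zip ms outcomes) ->
      vn_entropy (record_state rho (zip ms outcomes)) < vn_entropy rho.
Proof.
have [n [g [g_stab rhoE]]] := rho_stab; rewrite prod_average in rhoE.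
have GR := stab_rep_involutive g_stab; have AR := local_rep_involutive R D.
rewrite -[average (monomial _)]/(average (stab_rep R g)) in rhoE.
have rho_herm : rho^t* = rho.
  by rewrite rhoE trmxC_scale fmorphV rmorphXn /= conjC_nat (average_herm GR).
have rho_sqr : rho *m rho = 2 ^- (L - n) *: rho.
  by rewrite rhoE -[(_ *: _) *m _]scalemxAl -[_ *m (_ *: _)]scalemxAr (average_idem GR).
have lt_nL : (n < L)%N.
  (* If [L <= n], the truncated exponent [L - n] is 0, so [rho] has flat eigenvalue 1 and zero
     entropy, against [rho_mixed]. *)
  rewrite ltnNge; apply/negP => /eqP Ln0.
  move: rho_mixed; rewrite (vn_entropy_flat rho_herm rho_sqr) Ln0 log2_pow.
  by rewrite oppr0 mul0r oppr0 ltxx.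
have LnE : (L - n + n)%N = L by rewrite subnK // ltnW.
have two_neq0 k : 2 ^+ k != 0 :> R[i] by rewrite expf_neq0 // pnatr_eq0.
have tr_rho : \tr rho = 1.
  rewrite rhoE mxtraceZ (trace_stab_average g_stab) -[in 2 ^+ L]LnE exprD mulfK //.
  exact: mulVf.
have rank_lt : (\rank (anticommutation g D) < M)%N.
  by rewrite -(ltr_nat R) -(stab_state_coherence g_stab D LnE) -rhoE.
have [u uB u_unstab] := unstabilized_exists g_stab D lt_nL.
have [t [w [wB w_unstab]]] := sparse_kernel_witness (stabilized0 R g D)
  (@stabilizedD R L n g D) rank_lt uB u_unstab.
exists [tuple (t k, D (t k)) | k < M] => outcomes prob_gt0.
pose o := tnth outcomes.
have zipE := zip_basis_record D t (o := o) (outcomes := outcomes) (fun _ => erefl).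
have [||probE stateE] := @record_basisE R L D rho [seq (t k, o k) | k <- enum 'I_M].
- exact: tr_rho.
- by rewrite -zipE gt_eqF.
move: probE stateE prob_gt0; rewrite -zipE record_proj_average => probE -> prob_gt0.
rewrite probE in prob_gt0 *; rewrite rhoE in rho_herm rho_sqr prob_gt0 tr_rho *.
have aR := measured_rep_involutive R D t o.
set a := measured_rep R D t o in aR prob_gt0 *.
set P := average (stab_rep R g) in rho_herm rho_sqr tr_rho prob_gt0 *.
have aG x v : a x *m stab_rep R g v =
    sgn ((x *m (rowsub t 1%:M *m anticommutation g D) *m v^T) 0 0) *: (stab_rep R g v *m a x).
  rewrite /a /measured_rep -scalemxAl local_rep_stab_rep -scalemxAr !scalerA mulrC.
  by rewrite mulmxA.
(* The outcomes give [a w] a sign relative to the local string of [w]. If [a w] fixed [P], that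
   string would send [P] to [P] or [-P], and either makes it stabilized. *)
have awP : a w *m P != P.
  apply: contraNneq w_unstab; rewrite /stabilized -/P /a /measured_rep -scalemxAl.
  case: (F2_cases (\sum_k w 0 k * (o k)%:R)) => ->; rewrite /sgn.
    by rewrite scale1r => ->; rewrite eqxx.
  by rewrite expr1 scaleN1r => /(canRL (@opprK _)) ->; rewrite eqxx orbT.
have l_gt0 : 0 < 2 ^- (L - n) :> R[i] by rewrite invr_gt0 exprn_gt0 ?ltr0n.
rewrite -mulmxA in wB.
have [l' [l_lt post_herm post_sqr]] := post_state_flat aR GR aG l_gt0 tr_rho wB awP prob_gt0.
apply: flat_entropy_lt rho_herm rho_sqr tr_rho post_herm post_sqr _ l_gt0 l_lt.
by rewrite mxtraceZ mulVf // gt_eqF.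
Qed.
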